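(* For every integer $n\ge 1$ there exist a differential field $K$ of characteristic $0$ with algebraically closed field of constants $C$ and a Picard-Vessiot extension $M=K(u_1,\dots,u_n)$ of $K$, with $(u_1,\dots,u_n)$ a fundamental system of solutions of a homogeneous linear differential equation of order $n$ over $K$, whose differential Galois group is the whole linear group $GL_n(C)$; i.e. the matrices $(c_{ij})$ defined by $\sigma u_i=\sum_j c_{ij}u_j$, for $\sigma$ in the differential Galois group of $M/K$, are exactly all elements of $GL_n(C)$.
   Context: A differential field is a field with one derivation $y\mapsto y'$; its constants are the elements of derivative zero. For elements $u_1,\dots,u_n$ of a differential extension of $K$, $K(u_1,\dots,u_n)$ denotes the differential subfield generated by $K$ and $u_1,\dots,u_n$. Elements $u_1,\dots,u_n$ that are solutions of a homogeneous linear differential equation of order $n$ over $K$ form a fundamental system of solutions if their wronskian $\det(u_i^{(j-1)})_{1\le i,j\le n}$ is nonzero. A differential extension $M\supseteq K$ is a Picard-Vessiot extension of $K$ if $M=K(u_1,\dots,u_n)$ for a fundamental system of solutions of some homogeneous linear differential equation over $K$ and $M$ has the same field of constants as $K$. The differential Galois group of $M/K$ is the group of all differential field automorphisms of $M$ fixing $K$ elementwise. *)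

(* Defs.v *)
From HB Require Import structures.
From mathcomp Require Import all_boot all_algebra.

Set Implicit Arguments.
Unset Strict Implicit.
Unset Printing Implicit Defensive.

Import GRing.Theory.
Local Open Scope ring_scope.

HB.mixin Record Field_isDifferential F of GRing.Field F := {
  der : F -> F;
  derD : forall x y : F, der (x + y) = der x + der y;
  derM : forall x y : F, der (x * y) = der x * y + x * der y
}.

#[short(type="diffFieldType")]
HB.structure Definition DiffField := { F of Field_isDifferential F & GRing.Field F }.

Definition is_const (K : diffFieldType) : {pred K} := fun x => der x == 0.

Lemma is_const_divring_closed (K : diffFieldType) : divring_closed (@is_const K).
Proof.
have d0 : der (0 : K) = 0.
  by apply: (addrI (der (0 : K))); rewrite -derD !addr0.
have dN (x : K) : der (- x) = - der x.
  by apply/eqP; rewrite -addr_eq0 -derD addNr d0.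
have d1 : der (1 : K) = 0.
  apply: (addrI (der (1 : K))); rewrite addr0.
  by have := derM (1 : K) 1; rewrite !mulr1 mul1r => {3}->.
split=> [|x y /eqP dx /eqP dy|x y /eqP dx /eqP dy]; apply/eqP.
- exact: d1.
- by rewrite derD dN dx dy subrr.
- rewrite derM dx mul0r add0r; have [->|y0] := eqVneq y 0.
    by rewrite invr0 d0 mulr0.
  have : der (y * y^-1) = 0 by rewrite divff.
  rewrite derM dy mul0r add0r => /eqP.
  by rewrite mulf_eq0 (negPf y0) => /eqP ->; rewrite mulr0.
Qed.

HB.instance Definition _ (K : diffFieldType) :=
  GRing.isDivringClosed.Build K (@is_const K) (is_const_divring_closed K).

(* The field of constants, as a type with its inherited field structure. *)
Record constants (K : diffFieldType) := Constant {
  const_val : K;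
  const_valP : const_val \in @is_const K
}.

HB.instance Definition _ (K : diffFieldType) := [isSub for @const_val K].
HB.instance Definition _ (K : diffFieldType) := [Choice of constants K by <:].
HB.instance Definition _ (K : diffFieldType) :=
  [SubChoice_isSubIntegralDomain of constants K by <:].
HB.instance Definition _ (K : diffFieldType) :=
  [SubIntegralDomain_isSubField of constants K by <:].

(* A differential extension M of K is given by an embedding iota : K -> M
   satisfying diff_morphism iota. *)
Definition diff_morphism (K M : diffFieldType) (f : {rmorphism K -> M}) : Prop :=
  forall x : K, f (der x) = der (f x).

Definition diff_subfield (M : diffFieldType) (P : M -> Prop) : Prop :=
  [/\ P 1,
      forall x y, P x -> P y -> P (x - y),
      forall x y, P x -> P y -> P (x / y) &
      forall x, P x -> P (der x)].

(* The differential subfield K(u_1, ..., u_n) of M. *)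
Definition diff_adjoin (K M : diffFieldType) (iota : {rmorphism K -> M})
    (n : nat) (u : 'I_n -> M) : M -> Prop :=
  fun x => forall P : M -> Prop, diff_subfield P ->
    (forall k : K, P (iota k)) -> (forall i, P (u i)) -> P x.

(* y is a solution of a_n y^(n) + ... + a_1 y' + a_0 y = 0; the order is n
   exactly when a_n != 0. *)
Definition lin_diff_solution (K M : diffFieldType) (iota : {rmorphism K -> M})
    (n : nat) (a : 'I_n.+1 -> K) (y : M) : Prop :=
  \sum_(j < n.+1) iota (a j) * iter j der y = 0.

Definition wronskian (M : diffFieldType) (n : nat) (u : 'I_n -> M) : M :=
  \det (\matrix_(i < n, j < n) iter j der (u i)).

Definition fundamental_system (K M : diffFieldType) (iota : {rmorphism K -> M})
    (n : nat) (a : 'I_n.+1 -> K) (u : 'I_n -> M) : Prop :=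
  [/\ a ord_max != 0,
      forall i, lin_diff_solution iota a (u i) &
      wronskian u != 0].

Definition same_constants (K M : diffFieldType) (iota : {rmorphism K -> M}) : Prop :=
  forall x : M, x \in @is_const M <-> exists c : constants K, x = iota (const_val c).

(* Picard-Vessiot extension generated by the given fundamental system u of the
   equation with coefficients a. *)
Definition Picard_Vessiot_by (K M : diffFieldType) (iota : {rmorphism K -> M})
    (n : nat) (a : 'I_n.+1 -> K) (u : 'I_n -> M) : Prop :=
  [/\ diff_morphism iota,
      fundamental_system iota a u,
      forall x : M, diff_adjoin iota u x &
      same_constants iota].

(* Membership in the differential Galois group of M / K. *)
Definition diff_Galois (K M : diffFieldType) (iota : {rmorphism K -> M})
    (sigma : {rmorphism M -> M}) : Prop :=
  [/\ bijective sigma,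
      diff_morphism sigma &
      forall k : K, sigma (iota k) = iota k].

(* sigma u_i = \sum_j c_ij u_j, with C the constants of K. *)
Definition acts_by_matrix (K M : diffFieldType) (iota : {rmorphism K -> M})
    (n : nat) (u : 'I_n -> M) (sigma : {rmorphism M -> M})
    (c : 'M[constants K]_n) : Prop :=
  forall i, sigma (u i) = \sum_(j < n) iota (const_val (c i j)) * u j.

(* Main.v *)
Require Import Defs.
From HB Require Import structures.
From mathcomp Require Import all_boot all_algebra all_field.
From mathcomp Require Import boolp functions.
From mathcomp Require Import ring.
Set Implicit Arguments.
Unset Strict Implicit.
Unset Printing Implicit Defensive.
Import GRing.Theory.
Local Open Scope ring_scope.
Local Notation "x %:F" := (@FracField.tofrac _ x).

(** M is the field of differential rational functions C<u_1, ..., u_n> in n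
    differential indeterminates, GL_n(C) acts on it by linear substitution of
    the u_i, and K is the fixed field of this action. The wronskian of the u_i
    is nonzero, and Cramer's rule gives a monic equation of order n satisfied by
    the u_i whose coefficients are invariant under the action, hence lie in K.
    Any automorphism of M over K maps the u_i to solutions of this equation, which
    are the combinations of the u_i with constant coefficients; conversely each
    linear substitution fixes K by construction.

    It remains to see that M has no constants besides C. A differential
    polynomial is realised as the function w |-> f(w) it induces on arcs
    w in C[t]^n, so that its derivative is taken pointwise in C[t]. The value of
    f(w) at a point a only depends on a finite jet of w at a, and jets at two
    distinct points can be prescribed independently. If f/g is a constant, then
    f(w)/g(w) is constant in t for each arc w, and interpolating between two
    arcs shows that the constant does not depend on w. The same interpolation
    shows that the ring of differential polynomials is an integral domain. *)

(** * Wronskians and fixed fields *)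

Section DerivationTheory.
Variable M : diffFieldType.
Implicit Types (x y : M).

Fact der_is_zmod_morphism : zmod_morphism (@der M).
Proof.
have d0 : der (0 : M) = 0.
  by apply: (addrI (der (0 : M))); rewrite -derD !addr0.
have dN x : der (- x) = - der x.
  by apply/eqP; rewrite -addr_eq0 -derD addNr d0.
by move=> x y; rewrite derD dN.
Qed.
HB.instance Definition _ :=
  GRing.isZmodMorphism.Build M M (@der M) der_is_zmod_morphism.

Lemma iter_der_sum n (c : 'I_n -> M) (y : 'I_n -> M) k :
  (forall i, der (c i) = 0) ->
  iter k der (\sum_i c i * y i) = \sum_i c i * iter k der (y i).
Proof.
move=> dc; elim: k => //= k ->; rewrite raddf_sum; apply: eq_bigr => i _ /=.
by rewrite derM dc mul0r add0r.
Qed.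

Lemma diff_morphism_iter (s : {rmorphism M -> M}) k x :
  diff_morphism s -> s (iter k der x) = iter k der (s x).
Proof. by move=> ds; elim: k => //= k <-; rewrite ds. Qed.

Lemma diff_subfield_eq (s t : {rmorphism M -> M}) :
  diff_morphism s -> diff_morphism t ->
  diff_subfield (fun x : M => s x = t x).
Proof.
move=> ds dt; split=> [|x y xs ys|x y xs ys|x xs].
- by rewrite !rmorph1.
- by rewrite !rmorphB xs ys.
- by rewrite !fmorph_div xs ys.
- by rewrite ds dt xs.
Qed.

Section Wronskian.
Variables (n : nat) (u : 'I_n -> M).

Definition wronskian_mx : 'M[M]_n := \matrix_(i, j) iter j der (u i).

Hypothesis wu : wronskian u != 0.

Lemma wronskian_mx_unit : wronskian_mx \in unitmx.
Proof. by rewrite unitmxE unitfE. Qed.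

Lemma wronskian_mx_left_reg m (c : 'M[M]_(m, n)) : c *m wronskian_mx = 0 -> c = 0.
Proof.
by move=> /(congr1 (mulmx^~ (invmx wronskian_mx))); rewrite mulmxK ?mul0mx ?wronskian_mx_unit.
Qed.

(** Differentiating a relation with constant coefficients [j < n] times makes the coefficient row
    annihilate the wronskian matrix, which is invertible. *)
Lemma wronskian_const_free (c d : 'I_n -> M) :
  (forall i, der (c i) = 0) -> (forall i, der (d i) = 0) ->
  \sum_i c i * u i = \sum_i d i * u i -> c =1 d.
Proof.
move=> dc dd e i; suff /rowP/(_ i) : \row_i c i = \row_i d i :> 'rV[M]_n by rewrite !mxE.
apply/eqP; rewrite -subr_eq0; apply/eqP/wronskian_mx_left_reg.
rewrite mulmxBl; apply/eqP; rewrite subr_eq0; apply/eqP/rowP => j.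
rewrite !mxE; have /= := congr1 (iter j der) e; rewrite !iter_der_sum //.
by under eq_bigr do rewrite !mxE; move=> ->; apply: eq_bigr => k _; rewrite !mxE.
Qed.

(** Variation of constants: inverting the wronskian matrix gives [c] with
    [y^(j) = sum_i c_i u_i^(j)] for [j < n], and the equation extends this to [j = n].
    Differentiating the relation of order [j] and comparing with the one of order [j+1] leaves
    [sum_i c_i' u_i^(j) = 0] for all [j < n], so [c' = 0]. *)
Lemma wronskian_solution_span (b : 'I_n.+1 -> M) (y : M) :
  b ord_max != 0 ->
  (forall i, \sum_(j < n.+1) b j * iter j der (u i) = 0) ->
  \sum_(j < n.+1) b j * iter j der y = 0 ->
  exists2 c : 'I_n -> M, forall i, der (c i) = 0 & y = \sum_i c i * u i.
Proof.
move=> bn bu byz.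
pose c := (\row_j iter j der y) *m invmx wronskian_mx.
have cW : c *m wronskian_mx = \row_j iter j der y.
  by rewrite mulmxKV ?wronskian_mx_unit.
have lt_n (j : 'I_n) : iter j der y = \sum_i c 0 i * iter j der (u i).
  have /rowP/(_ j) := cW; rewrite !mxE => <-.
  by apply: eq_bigr => i _; rewrite !mxE.
have le_n (j : 'I_n.+1) : iter j der y = \sum_i c 0 i * iter j der (u i).
  case: (unliftP ord_max j) => [k ->|->]; first by rewrite lift_max lt_n.
  (* In the equation applied to the difference of both sides, the terms of order below [n] vanish by
     [lt_n]; only the top one, with nonzero coefficient, remains. *)
  apply/eqP; rewrite -subr_eq0 -(mulrI_eq0 _ (mulfI bn)); apply/eqP.
  transitivity (\sum_(j < n.+1) b j *
      (iter j der y - \sum_i c 0 i * iter j der (u i))).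
    rewrite big_ord_recr /= [X in _ = X + _]big1 ?add0r // => i _.
    by rewrite [X in X - _](lt_n i) subrr mulr0.
  under eq_bigr do rewrite mulrBr mulr_sumr.
  rewrite sumrB byz exchange_big big1 ?subr0 // => i _.
  by under eq_bigr do rewrite mulrCA; rewrite -mulr_sumr bu mulr0.
exists (c 0) => [i|]; last exact: (le_n ord0).
suff /rowP/(_ i) : map_mx der c = 0 by rewrite !mxE.
apply: wronskian_mx_left_reg; apply/rowP => j; rewrite !mxE.
have e : der (\sum_i c 0 i * iter j der (u i)) = \sum_i c 0 i * iter j.+1 der (u i).
  by rewrite -lt_n -[LHS]/(iter j.+1 der y) -(le_n (lift ord0 j)) lift0.
move/eqP: e; rewrite raddf_sum -subr_eq0 -sumrB => /eqP e; rewrite -[RHS]e.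
by apply: eq_bigr => k _; rewrite !mxE /= derM addrK.
Qed.

End Wronskian.
End DerivationTheory.

(** * Fixed fields of differential endomorphisms *)

Section FixedField.
Variables (M : diffFieldType) (P : {rmorphism M -> M} -> Prop).

(** Only the differential members of [P] have to fix [x]; commuting with [der] is what makes the
    fixed elements closed under [der]. *)
Definition is_fixed : {pred M} :=
  fun x => `[< forall s, P s -> diff_morphism s -> s x = x >].

Lemma is_fixed_divring_closed : divring_closed is_fixed.
Proof.
split=> [|x y /asboolP fx /asboolP fy|x y /asboolP fx /asboolP fy];
  apply/asboolP => s Ps ds.
- exact: rmorph1.
- by rewrite rmorphB fx ?fy.
- by rewrite fmorph_div fx ?fy.
Qed.

HB.instance Definition _ :=
  GRing.isDivringClosed.Build M is_fixed is_fixed_divring_closed.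

Record fixed_field := Fixed { fixed_val : M; fixed_valP : fixed_val \in is_fixed }.

HB.instance Definition _ := [isSub for fixed_val].
HB.instance Definition _ := [Choice of fixed_field by <:].
HB.instance Definition _ := [SubChoice_isSubIntegralDomain of fixed_field by <:].
HB.instance Definition _ := [SubIntegralDomain_isSubField of fixed_field by <:].

Fact fixed_der_subproof (x : fixed_field) : der (val x) \in is_fixed.
Proof.
apply/asboolP => s Ps ds; rewrite ds; congr der.
by have /asboolP := valP x; apply.
Qed.
Definition fixed_der (x : fixed_field) := Fixed (fixed_der_subproof x).

Fact fixed_derD x y : fixed_der (x + y) = fixed_der x + fixed_der y.
Proof. by apply: val_inj; exact: derD. Qed.
Fact fixed_derM x y : fixed_der (x * y) = fixed_der x * y + x * fixed_der y.
Proof. by apply: val_inj; exact: derM. Qed.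

HB.instance Definition _ :=
  Field_isDifferential.Build fixed_field fixed_derD fixed_derM.

Definition fixed_incl : {rmorphism fixed_field -> M} := val : fixed_field -> M.

Lemma fixed_incl_diff : diff_morphism fixed_incl.
Proof. by []. Qed.

Lemma fixed_inclP x : (forall s, P s -> diff_morphism s -> s x = x) ->
  exists k, x = fixed_incl k.
Proof. by move=> /asboolP fx; exists (Fixed fx). Qed.

Lemma fixed_incl_fix k s : P s -> diff_morphism s -> s (fixed_incl k) = fixed_incl k.
Proof. by move=> Ps ds; have /asboolP := fixed_valP k; apply. Qed.
End FixedField.

(** * Derivations and morphisms of fields of fractions *)

Section Fractions.
Variable R : idomainType.
Implicit Types (x : {fraction R}) (p q : R).

Lemma fraction_div x : exists pq : R * R, pq.2 != 0 /\ x = pq.1%:F / pq.2%:F.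
Proof.
elim/quotW: x => r; exists (frac r); split; first exact: denom_ratioP.
unlock FracField.tofrac; rewrite -[_^-1]FracField.pi_inv -[RHS]FracField.pi_mul.
by rewrite /FracField.mulf /FracField.invf !numden_Ratio ?oner_eq0 ?denom_ratioP //
  mulr1 mul1r Ratio_numden.
Qed.

(** Representatives are chosen arbitrarily; [fraction_numP] compares them with any other pair, and
    independence of the choice has to be shown for each construction below. *)
Definition fraction_num x : R := (projT1 (cid (fraction_div x))).1.
Definition fraction_den x : R := (projT1 (cid (fraction_div x))).2.

Lemma fraction_den_neq0 x : fraction_den x != 0.
Proof. by rewrite /fraction_den; case: cid => -[p q] []. Qed.

Lemma fraction_num_den x : x = (fraction_num x)%:F / (fraction_den x)%:F.
Proof. by rewrite /fraction_num /fraction_den; case: cid => -[p q] []. Qed.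

Lemma fraction_numP p q : q != 0 ->
  p * fraction_den (p%:F / q%:F) = fraction_num (p%:F / q%:F) * q.
Proof.
move=> q0; apply/eqP; rewrite -tofrac_eq !rmorphM -eqr_div ?tofrac_eq0 //.
  by rewrite -fraction_num_den.
exact: fraction_den_neq0.
Qed.

Section Derivation.
Variable D : R -> R.
Hypothesis DD : forall p q, D (p + q) = D p + D q.
Hypothesis DM : forall p q, D (p * q) = D p * q + p * D q.

Definition fraction_der x : {fraction R} :=
  let p := fraction_num x in let q := fraction_den x in
  (D p * q - p * D q)%:F / (q ^+ 2)%:F.

(** The quotient rule does not depend on the representing pair: the cross-multiplied difference is a
    combination of [p * d = n * q] and of its derivative. *)
Lemma fraction_der_div p q : q != 0 ->
  fraction_der (p%:F / q%:F) = (D p * q - p * D q)%:F / (q ^+ 2)%:F.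
Proof.
move=> q0; have := fraction_numP p q0; rewrite /fraction_der.
have := fraction_den_neq0 (p%:F / q%:F).
move: (fraction_num _) (fraction_den _) => n d d0 e.
have e' := congr1 D e; rewrite !DM in e'.
apply/eqP; rewrite eqr_div ?tofrac_eq0 ?expf_neq0 // -!tofracM tofrac_eq.
rewrite -subr_eq0; apply/eqP.
transitivity ((D q * d + D d * q) * (p * d - n * q)
  - d * q * (D p * d + p * D d - (D n * q + n * D q))); first by ring.
by rewrite e e' !subrr !mulr0 subrr.
Qed.

Lemma fraction_derD x y : fraction_der (x + y) = fraction_der x + fraction_der y.
Proof.
rewrite [in LHS](fraction_num_den x) [in LHS](fraction_num_den y) [in RHS]/fraction_der.
have := fraction_den_neq0 x; have := fraction_den_neq0 y.
move: (fraction_num x) (fraction_den x) (fraction_num y) (fraction_den y).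
move=> p q n d d0 q0; rewrite !addf_div ?tofrac_eq0 ?expf_neq0 //.
rewrite -!tofracM -!tofracD fraction_der_div ?mulf_neq0 //.
rewrite DD !DM; apply/eqP; rewrite eqr_div ?tofrac_eq0 ?expf_neq0 ?mulf_neq0 ?expf_neq0 //.
rewrite -!tofracM tofrac_eq; apply/eqP; ring.
Qed.

Lemma fraction_derM x y :
  fraction_der (x * y) = fraction_der x * y + x * fraction_der y.
Proof.
rewrite [in LHS](fraction_num_den x) [in LHS](fraction_num_den y).
rewrite [X in _ = _ * X + _](fraction_num_den y) [X in _ = _ + X * _](fraction_num_den x).
rewrite [in RHS]/fraction_der.
have := fraction_den_neq0 x; have := fraction_den_neq0 y.
move: (fraction_num x) (fraction_den x) (fraction_num y) (fraction_den y).
move=> p q n d d0 q0; rewrite !mulf_div -!tofracM.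
rewrite fraction_der_div ?mulf_neq0 // addf_div ?tofrac_eq0 ?mulf_neq0 ?expf_neq0 //.
rewrite !DM -!tofracM -!tofracD; apply/eqP.
rewrite eqr_div ?tofrac_eq0 ?mulf_neq0 ?expf_neq0 ?mulf_neq0 //.
rewrite -!tofracM tofrac_eq; apply/eqP; ring.
Qed.

Lemma fraction_der_tofrac p : fraction_der p%:F = (D p)%:F.
Proof.
have D1 : D 1 = 0.
  by apply: (addrI (D 1)); rewrite addr0 -[in RHS](mulr1 1) DM mulr1 mul1r.
by rewrite -[p%:F]divr1 -tofrac1 fraction_der_div ?oner_neq0 // D1 mulr0 subr0 mulr1
  expr1n tofrac1 divr1.
Qed.
End Derivation.

Section Lift.
Variables (L : fieldType) (f : {rmorphism R -> L}).
Hypothesis f_inj : injective f.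

(** Injectivity of [f] keeps the images of denominators nonzero. *)
Definition fraction_lift x : L := f (fraction_num x) / f (fraction_den x).

Let f_eq0 p : (f p == 0) = (p == 0).
Proof. by rewrite -(rmorph0 f) (inj_eq f_inj). Qed.

Lemma fraction_lift_div p q : q != 0 -> fraction_lift (p%:F / q%:F) = f p / f q.
Proof.
move=> q0; apply/eqP; rewrite eqr_div ?f_eq0 ?fraction_den_neq0 // -!rmorphM.
by rewrite fraction_numP.
Qed.

Fact fraction_lift_zmod_morphism : zmod_morphism fraction_lift.
Proof.
move=> x y; rewrite [in LHS](fraction_num_den x) [in LHS](fraction_num_den y).
rewrite -mulNr -tofracN addf_div ?tofrac_eq0 ?fraction_den_neq0 //.
rewrite -!tofracM -tofracD fraction_lift_div ?mulf_neq0 ?fraction_den_neq0 //.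
rewrite rmorphD !rmorphM -addf_div ?f_eq0 ?fraction_den_neq0 //.
by rewrite rmorphN mulNr.
Qed.

Fact fraction_lift_monoid_morphism : monoid_morphism fraction_lift.
Proof.
split=> [|x y].
  by rewrite -[1]divr1 -tofrac1 fraction_lift_div ?oner_neq0 // rmorph1 divr1.
rewrite [in LHS](fraction_num_den x) [in LHS](fraction_num_den y) mulf_div.
by rewrite -!tofracM fraction_lift_div ?mulf_neq0 ?fraction_den_neq0 // !rmorphM -mulf_div.
Qed.

HB.instance Definition _ := GRing.isZmodMorphism.Build {fraction R} L
  fraction_lift fraction_lift_zmod_morphism.
HB.instance Definition _ := GRing.isMonoidMorphism.Build {fraction R} L
  fraction_lift fraction_lift_monoid_morphism.

Definition fraction_rmorphism : {rmorphism {fraction R} -> L} := fraction_lift.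

Lemma fraction_rmorphismE p : fraction_rmorphism p%:F = f p.
Proof.
by rewrite -[p%:F]divr1 -tofrac1 [LHS]fraction_lift_div ?oner_neq0 // rmorph1 divr1.
Qed.
End Lift.
End Fractions.

(** * Differential polynomials as functions on arcs *)

Section PolyWronskian.
Variable F : fieldType.
Hypothesis pcharF : [pchar F] =i pred0.
Implicit Types p q : {poly F}.

(** In characteristic 0 the degree factor does not vanish, so the degree drops by exactly one; for
    constants both sides are 0. *)
Lemma lead_coef_deriv p : lead_coef p^`() = lead_coef p *+ (size p).-1.
Proof.
have /pcharf0P natr0 := pcharF.
have [p1|p2] := leqP (size p) 1.
  by rewrite (size1_polyC p1) derivC lead_coef0 size_polyC; case: eqP; rewrite mulr0n.
have e : (size p).-2.+1 = (size p).-1 by case: (size p) p2 => [|[]].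
have c : p^`()`_(size p).-2 = lead_coef p *+ (size p).-1 by rewrite coef_deriv e.
have p0 : p != 0 by rewrite -size_poly_gt0 ltnW.
have c0 : p^`()`_(size p).-2 != 0.
  rewrite c -mulr_natr mulf_eq0 lead_coef_eq0 (negPf p0) natr0 -e //.
rewrite -c lead_coefE; congr (_`__); apply/eqP; rewrite eqn_leq; apply/andP; split.
  have := lt_size_deriv p0; case: (size p^`()) => // k; case: (size p) p2 => [|[]] //.
by rewrite -ltnS; case: ltnP c0 => // h; rewrite nth_default ?eqxx //;
  case: (size p^`()) h.
Qed.

(** Leading coefficients of both sides differ only by the factors [deg p] and [deg q], which must
    agree in characteristic 0. *)
Lemma wronskian0_size p q : p != 0 -> q != 0 ->
  p^`() * q = p * q^`() -> (size p).-1 = (size q).-1.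
Proof.
have /pcharf0P natr0 := pcharF.
move=> p0 q0 /(congr1 lead_coef); rewrite !lead_coefM !lead_coef_deriv.
rewrite mulrnAl mulrnAr => /eqP; rewrite -subr_eq0.
have lpq : lead_coef p * lead_coef q != 0 by rewrite mulf_neq0 ?lead_coef_eq0.
wlog le_qp : p q p0 q0 lpq / ((size q).-1 <= (size p).-1)%N.
  move=> h; case/orP: (leq_total (size q).-1 (size p).-1); first exact: h.
  move=> le e; symmetry; apply: h => //; first by rewrite mulrC.
  by rewrite -opprB oppr_eq0 mulrC.
rewrite -mulrnBr // -mulr_natr mulf_eq0 (negPf lpq) natr0 subn_eq0 /= => le_pq.
by apply/eqP; rewrite eqn_leq; apply/andP.
Qed.

(** With [c] the ratio of leading coefficients, [p - c *: q] satisfies the same relation with [q].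
    If nonzero it would have the degree of [q], but its coefficient there cancels. *)
Lemma wronskian0_proportional p q : q != 0 ->
  p^`() * q = p * q^`() -> exists c, p = c *: q.
Proof.
move=> q0 e; have [->|p0] := eqVneq p 0; first by exists 0; rewrite scale0r.
have spq := wronskian0_size p0 q0 e.
pose c := lead_coef p / lead_coef q; exists c.
apply/eqP; rewrite -subr_eq0; apply/negPn/negP => r0.
have er : (p - c *: q)^`() * q = (p - c *: q) * q^`().
  by rewrite derivB derivZ mulrBl e [RHS]mulrBl -!scalerAl [q^`() * q]mulrC.
have := wronskian0_size r0 q0 er; rewrite -spq.
have s_pos (r : {poly F}) : r != 0 -> size r = (size r).-1.+1.
  by move=> ?; rewrite prednK // size_poly_gt0.
move=> sr; have : lead_coef (p - c *: q) = 0.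
  rewrite lead_coefE sr coefB coefZ -lead_coefE spq -lead_coefE.
  by rewrite /c divfK ?lead_coef_eq0 // subrr.
by move/eqP; rewrite lead_coef_eq0 (negPf r0).
Qed.
End PolyWronskian.

(** * Differential polynomial functions, jets and interpolation of arcs *)

Section DiffPoly.
Variables (C : closedFieldType) (n : nat).
Local Notation arc := 'rV[{poly C}]_n.

Inductive diffpoly : (arc -> {poly C}) -> Prop :=
  | diffpoly_const c : diffpoly (fun=> c%:P)
  | diffpoly_coord i : diffpoly (fun w => w 0 i)
  | diffpoly_sub f g : diffpoly f -> diffpoly g -> diffpoly (f - g)
  | diffpoly_mul f g : diffpoly f -> diffpoly g -> diffpoly (f * g)
  | diffpoly_der f : diffpoly f -> diffpoly (fun w => (f w)^`()).

Lemma dvdp_deriv_exp (d h : {poly C}) k : d ^+ k.+1 %| h -> d ^+ k %| h^`().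
Proof.
case/dvdpP=> q ->; rewrite derivM deriv_exp /= dvdp_add //.
  by rewrite exprS mulrA dvdp_mull.
by rewrite mulrnAr -mulrnAl mulrA dvdp_mulIr.
Qed.

(** Here [m] bounds the number of derivatives taken in [f], each of which costs one order of
    contact; for differences and products [m + l] dominates both bounds. *)
Lemma diffpoly_local f : diffpoly f -> exists m, forall (d : {poly C}) k (w z : arc),
  (forall i, d ^+ (m + k) %| w 0 i - z 0 i) -> d ^+ k %| f w - f z.
Proof.
elim=> [c|i|g h _ [m mg] _ [l lh]|g h _ [m mg] _ [l lh]|g _ [m mg]].
- by exists 0%N => d k w z _; rewrite subrr dvdp0.
- by exists 0%N => d k w z.
- exists (m + l)%N => d k w z e.
  rewrite (_ : _ - _ = (g w - g z) - (h w - h z)); last by rewrite !fctE; ring.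
  rewrite dvdp_sub //.
    by apply: mg => i; apply: dvdp_trans (e i); rewrite dvdp_exp2l // leq_add2r leq_addr.
  by apply: lh => i; apply: dvdp_trans (e i); rewrite dvdp_exp2l // leq_add2r leq_addl.
- exists (m + l)%N => d k w z e.
  rewrite (_ : _ - _ = (g w - g z) * h w + g z * (h w - h z)); last by rewrite !fctE; ring.
  rewrite dvdp_add //; [apply: dvdp_mulr | apply: dvdp_mull].
    by apply: mg => i; apply: dvdp_trans (e i); rewrite dvdp_exp2l // leq_add2r leq_addr.
  by apply: lh => i; apply: dvdp_trans (e i); rewrite dvdp_exp2l // leq_add2r leq_addl.
- exists m.+1 => d k w z e; rewrite -derivB; apply: dvdp_deriv_exp.
  by apply: mg => i; rewrite addnS.
Qed.

Lemma diffpoly_jet f : diffpoly f -> exists m, forall a (w z : arc),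
  (forall i, ('X - a%:P) ^+ m %| w 0 i - z 0 i) -> (f w).[a] = (f z).[a].
Proof.
case/diffpoly_local=> m fm; exists (m + 1)%N => a w z e.
have := fm ('X - a%:P) 1%N w z e; rewrite expr1 dvdp_XsubCl rootE hornerD hornerN.
by rewrite subr_eq0 => /eqP.
Qed.

Lemma arc_interpolation (a b : C) m (w z : arc) : a != b -> exists v : arc,
  (forall i, ('X - a%:P) ^+ m %| v 0 i - w 0 i) /\
  (forall i, ('X - b%:P) ^+ m %| v 0 i - z 0 i).
Proof.
move=> ab; have : coprimep (('X - a%:P) ^+ m) (('X - b%:P) ^+ m).
  by rewrite coprimep_expl // coprimep_expr // coprimep_XsubC2 // subr_eq0 eq_sym.
set A := _ ^+ m; set B := _ ^+ m; case/Bezout_eq1_coprimepP => -[p q] /= e.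
(* Chinese remainders: since [p * A + q * B = 1], the factor [q * B] is 1 modulo [A] and 0 modulo
   [B], and [p * A] the reverse. *)
exists (\row_i (z 0 i * (p * A) + w 0 i * (q * B))); split=> i; rewrite mxE.
  rewrite (_ : _ - _ = (z 0 i - w 0 i) * p * A + w 0 i * (p * A + q * B - 1)); last by ring.
  by rewrite e subrr mulr0 addr0 dvdp_mulIr.
rewrite (_ : _ - _ = (w 0 i - z 0 i) * q * B + z 0 i * (p * A + q * B - 1)); last by ring.
by rewrite e subrr mulr0 addr0 dvdp_mulIr.
Qed.

Lemma diffpoly_interpolation f g a b (w z : arc) :
  diffpoly f -> diffpoly g -> a != b -> exists v,
  [/\ (f v).[a] = (f w).[a], (g v).[a] = (g w).[a],
      (f v).[b] = (f z).[b] & (g v).[b] = (g z).[b]].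
Proof.
move=> /diffpoly_jet[m fm] /diffpoly_jet[l gl] /(arc_interpolation (m + l) w z).
case=> v [vw vz]; exists v.
by split; (apply: fm || apply: gl) => i;
  (apply: dvdp_trans (vw i) || apply: dvdp_trans (vz i));
  rewrite dvdp_exp2l ?leq_addr ?leq_addl.
Qed.

Lemma nonroot_avoid (p : {poly C}) b : p != 0 -> exists2 a, a != b & p.[a] != 0.
Proof.
(* The extra factor vanishes at [b], so a nonroot of the product differs from [b]. *)
move=> p0; have : p * ('X - b%:P) != 0 by rewrite mulf_neq0 ?polyXsubC_eq0.
case/closed_nonrootP=> a; rewrite rootM root_XsubC negb_or => /andP[pa ab].
by exists a.
Qed.

Lemma diffpoly_neq0 (f : arc -> {poly C}) : f != 0 -> exists w, f w != 0.
Proof.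
move=> /eqP f0; apply: contrapT => h; apply: f0; apply/funext => w.
by apply/eqP/negPn/negP => fw; apply: h; exists w.
Qed.

(** An arc [v] imitating [w] at [a], where [f w] is nonzero, and [z] at [b], where [g z] is nonzero,
    makes both [f v] and [g v] nonzero in the domain [C[t]]. *)
Lemma diffpoly_mulf_neq0 f g : diffpoly f -> diffpoly g ->
  f != 0 -> g != 0 -> f * g != 0.
Proof.
move=> df dg /diffpoly_neq0[w fw] /diffpoly_neq0[z gz].
have [a _ fwa] := nonroot_avoid 0 fw; have [b ba gzb] := nonroot_avoid a gz.
rewrite eq_sym in ba; have [v [fva _ _ gvb]] := diffpoly_interpolation w z df dg ba.
apply/eqP => /(congr1 (fun h => h v)); rewrite !fctE => /eqP; rewrite mulf_eq0.
by case/orP=> /eqP e; [move: fwa; rewrite -fva|move: gzb; rewrite -gvb];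
  rewrite e horner0 eqxx.
Qed.

Lemma diffpoly_wronskian0 f g : [pchar C] =i pred0 -> diffpoly f -> diffpoly g ->
  g != 0 -> (forall w, (f w)^`() * g w = f w * (g w)^`()) ->
  exists c : C, forall w, f w = c%:P * g w.
Proof.
move=> pcharC df dg /diffpoly_neq0[w gw] e.
(* The ratio of [f] to [g] along [w] at [a] equals the ratio along [z] at [b]: both are read off the
   single arc [v], on which [f v] is a scalar multiple of [g v]. *)
have cross z a b : a != b ->
    (f w).[a] * (g z).[b] = (f z).[b] * (g w).[a].
  move=> ab; have [v [<- <- <- <-]] := diffpoly_interpolation w z df dg ab.
  have [gv0|gv0] := eqVneq (g v) 0; first by rewrite gv0 !horner0 !mulr0.
  have [c ->] := wronskian0_proportional pcharC gv0 (e v).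
  by rewrite !hornerZ; ring.
have [a _ gwa] := nonroot_avoid 0 gw.
(* The constant is the ratio at one point [a] of one arc. A nonzero [f z - c *: g z] would be
   nonzero at some [b != a], against [cross]. *)
exists ((f w).[a] / (g w).[a]) => z; rewrite mul_polyC.
apply/eqP; rewrite -subr_eq0; apply/negPn/negP => /(nonroot_avoid a)[b ba].
rewrite hornerD hornerN hornerZ => /negP; apply; rewrite subr_eq0 mulrAC cross 1?eq_sym //.
by rewrite mulfK.
Qed.

(** * The integral domain of differential polynomials *)

Definition is_diffpoly : {pred arc -> {poly C}} := fun f => `[< diffpoly f >].

Lemma is_diffpoly_subring_closed : subring_closed is_diffpoly.
Proof.
split=> [|f g /asboolP df /asboolP dg|f g /asboolP df /asboolP dg]; apply/asboolP.
- exact: diffpoly_const 1.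
- exact: diffpoly_sub.
- exact: diffpoly_mul.
Qed.

HB.instance Definition _ := GRing.isSubringClosed.Build (arc -> {poly C})
  is_diffpoly is_diffpoly_subring_closed.

Record diffpoly_ring := DiffPoly {
  diffpoly_val : arc -> {poly C};
  diffpoly_valP : diffpoly_val \in is_diffpoly }.

HB.instance Definition _ := [isSub for diffpoly_val].
HB.instance Definition _ := [Choice of diffpoly_ring by <:].
HB.instance Definition _ :=
  GRing.SubChoice_isSubComPzRing.Build _ _ diffpoly_ring is_diffpoly_subring_closed.

Fact diffpoly_ring_nonzero : (1 : diffpoly_ring) != 0.
Proof.
apply/eqP => /(congr1 val) /(congr1 (fun f => f 0)) /eqP.
by rewrite rmorph1 rmorph0 oner_eq0.
Qed.
HB.instance Definition _ :=
  GRing.PzSemiRing_isNonZero.Build diffpoly_ring diffpoly_ring_nonzero.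

(* idomainType requires a total inverse; here it is obtained by choice. *)
Definition diffpoly_unit : {pred diffpoly_ring} := fun f => `[< exists g, g * f = 1 >].
Definition diffpoly_inv (f : diffpoly_ring) : diffpoly_ring :=
  if pselect (exists g, g * f = 1) is left fU then projT1 (cid fU) else f.

Fact diffpoly_mulVx : {in diffpoly_unit, left_inverse 1 diffpoly_inv *%R}.
Proof.
by move=> f /asboolP fU; rewrite /diffpoly_inv; case: pselect => // ?; case: cid.
Qed.
Fact diffpoly_unitPl (f g : diffpoly_ring) : g * f = 1 -> diffpoly_unit f.
Proof. by move=> gf; apply/asboolP; exists g. Qed.
Fact diffpoly_invr_out : {in [predC diffpoly_unit], diffpoly_inv =1 id}.
Proof.
by move=> f /asboolPn fU; rewrite /diffpoly_inv; case: pselect.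
Qed.
HB.instance Definition _ := GRing.ComNzRing_hasMulInverse.Build diffpoly_ring
  diffpoly_mulVx diffpoly_unitPl diffpoly_invr_out.

Fact diffpoly_integral : GRing.integral_domain_axiom diffpoly_ring.
Proof.
move=> f g fg; apply/norP => -[f0 g0].
have /asboolP df := valP f; have /asboolP dg := valP g.
have /eqP[] : val f * val g != 0.
  by apply: diffpoly_mulf_neq0 => //; rewrite -(inj_eq val_inj) in f0 g0.
by rewrite -rmorphM fg.
Qed.
HB.instance Definition _ :=
  GRing.ComUnitRing_isIntegral.Build diffpoly_ring diffpoly_integral.

Definition to_diffpoly (f : arc -> {poly C}) (df : diffpoly f) : diffpoly_ring :=
  DiffPoly (introT (asboolP _) df : f \in is_diffpoly).

Lemma diffpoly_ringP (f : diffpoly_ring) : diffpoly (val f).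
Proof. by have /asboolP := valP f. Qed.

Definition dp_const (c : C) : diffpoly_ring := to_diffpoly (diffpoly_const c).
Definition dp_coord i : diffpoly_ring := to_diffpoly (diffpoly_coord i).
Definition dp_der (f : diffpoly_ring) : diffpoly_ring :=
  to_diffpoly (diffpoly_der (diffpoly_ringP f)).

Fact dp_derD f g : dp_der (f + g) = dp_der f + dp_der g.
Proof. by apply: val_inj; apply/funext => w; exact: derivD. Qed.

Fact dp_derM f g : dp_der (f * g) = dp_der f * g + f * dp_der g.
Proof. by apply: val_inj; apply/funext => w; exact: derivM. Qed.

Fact dp_const_zmod_morphism : zmod_morphism dp_const.
Proof. by move=> c d; apply: val_inj; apply/funext => w; exact: polyCB. Qed.
Fact dp_const_monoid_morphism : monoid_morphism dp_const.
Proof. by split=> [|c d]; apply: val_inj; apply/funext => w; rewrite //= polyCM. Qed.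
HB.instance Definition _ :=
  GRing.isZmodMorphism.Build C diffpoly_ring dp_const dp_const_zmod_morphism.
HB.instance Definition _ :=
  GRing.isMonoidMorphism.Build C diffpoly_ring dp_const dp_const_monoid_morphism.

Definition dp_eval (w : arc) (f : diffpoly_ring) : {poly C} := val f w.
Fact dp_eval_zmod_morphism w : zmod_morphism (dp_eval w). Proof. by []. Qed.
Fact dp_eval_monoid_morphism w : monoid_morphism (dp_eval w). Proof. by []. Qed.
HB.instance Definition _ w :=
  GRing.isZmodMorphism.Build diffpoly_ring {poly C} (dp_eval w) (dp_eval_zmod_morphism w).
HB.instance Definition _ w :=
  GRing.isMonoidMorphism.Build diffpoly_ring {poly C} (dp_eval w) (dp_eval_monoid_morphism w).

Lemma dp_evalP f g : (forall w, dp_eval w f = dp_eval w g) -> f = g.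
Proof. by move=> e; apply: val_inj; apply/funext => w; exact: e. Qed.

(** * Linear substitutions and the generic wronskian *)

Definition arc_act (c : 'M[C]_n) (w : arc) : arc := w *m (map_mx polyC c)^T.

Lemma arc_actE c w i : arc_act c w 0 i = \sum_j (c i j)%:P * w 0 j.
Proof. by rewrite mxE; apply: eq_bigr => j _; rewrite !mxE mulrC. Qed.

Lemma diffpoly_sum (f : 'I_n -> arc -> {poly C}) :
  (forall i, diffpoly (f i)) -> diffpoly (\sum_i f i).
Proof.
move=> df; have /rpred_sum h : forall i, true -> f i \in is_diffpoly.
  by move=> i _; apply/asboolP.
by have /asboolP := h (index_enum 'I_n).
Qed.

(** Precomposition commutes with the pointwise derivative, and the entries of [c] are constants, so
    each coordinate becomes a differential polynomial. *)
Lemma diffpoly_arc_act c f : diffpoly f -> diffpoly (f \o arc_act c).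
Proof.
elim=> [k|i|g h _ dg _ dh|g h _ dg _ dh|g _ dg].
- exact: diffpoly_const.
- rewrite (_ : _ \o _ = \sum_j (fun w : arc => (c i j)%:P * w 0 j)).
    apply: diffpoly_sum => j.
    exact: (diffpoly_mul (diffpoly_const _) (diffpoly_coord j)).
  by apply/funext => w; rewrite fct_sumE /= arc_actE.
- exact: diffpoly_sub dg dh.
- exact: diffpoly_mul dg dh.
- exact: diffpoly_der dg.
Qed.

Definition dp_act c (f : diffpoly_ring) : diffpoly_ring :=
  to_diffpoly (diffpoly_arc_act c (diffpoly_ringP f)).

Lemma dp_eval_act w c f : dp_eval w (dp_act c f) = dp_eval (arc_act c w) f.
Proof. by []. Qed.

Fact dp_act_zmod_morphism c : zmod_morphism (dp_act c).
Proof. by move=> f g; apply: dp_evalP => w; rewrite rmorphB !dp_eval_act rmorphB. Qed.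
Fact dp_act_monoid_morphism c : monoid_morphism (dp_act c).
Proof.
by split=> [|f g]; apply: dp_evalP => w; rewrite ?rmorphM !dp_eval_act ?rmorphM ?rmorph1.
Qed.
HB.instance Definition _ c := GRing.isZmodMorphism.Build diffpoly_ring diffpoly_ring
  (dp_act c) (dp_act_zmod_morphism c).
HB.instance Definition _ c := GRing.isMonoidMorphism.Build diffpoly_ring diffpoly_ring
  (dp_act c) (dp_act_monoid_morphism c).

(** For invertible [c] every arc has the form [arc_act c v], so values on such arcs determine a
    differential polynomial. *)
Lemma dp_act_inj c : c \in unitmx -> injective (dp_act c).
Proof.
move=> uc f g fg; apply: dp_evalP => w.
pose v := w *m invmx (map_mx polyC c)^T.
have -> : w = arc_act c v.
  by rewrite /arc_act mulmxKV // unitmx_tr map_unitmx.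
by rewrite -!dp_eval_act fg.
Qed.

Lemma dp_act_der c f : dp_act c (dp_der f) = dp_der (dp_act c f).
Proof. exact: dp_evalP. Qed.

Lemma dp_act_coord c i : dp_act c (dp_coord i) = \sum_j dp_const (c i j) * dp_coord j.
Proof.
apply: dp_evalP => w; rewrite dp_eval_act rmorph_sum.
by rewrite [LHS]arc_actE; apply: eq_bigr => j _; rewrite rmorphM.
Qed.

Lemma dp_act_const c k : dp_act c (dp_const k) = dp_const k.
Proof. exact: dp_evalP. Qed.

Lemma dp_generated (P : diffpoly_ring -> Prop) :
  (forall c, P (dp_const c)) -> (forall i, P (dp_coord i)) ->
  (forall f g, P f -> P g -> P (f - g)) -> (forall f g, P f -> P g -> P (f * g)) ->
  (forall f, P f -> P (dp_der f)) -> forall f, P f.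
Proof.
move=> Pc Pu PB PM PD [f fP]; have /asboolP df := fP.
(* The membership proof packed in [f] is not the one met in the induction, so the claim is stated
   for every element with underlying function [f]. *)
suff: forall r : diffpoly_ring, val r = f -> P r by apply.
elim: df => {f fP}[c|i|f g df Pf dg Pg|f g df Pf dg Pg|f df Pf] r rE.
- by rewrite (_ : r = dp_const c) //; apply: val_inj.
- by rewrite (_ : r = dp_coord i) //; apply: val_inj.
- rewrite (_ : r = to_diffpoly df - to_diffpoly dg); last exact: val_inj.
  by apply: PB; [apply: Pf | apply: Pg].
- rewrite (_ : r = to_diffpoly df * to_diffpoly dg); last exact: val_inj.
  by apply: PM; [apply: Pf | apply: Pg].
- rewrite (_ : r = dp_der (to_diffpoly df)); last exact: val_inj.
  by apply: PD; apply: Pf.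
Qed.

(** On the arc [(1, t, ..., t^(n-1))] the matrix is triangular with diagonal entries [i!], nonzero
    in characteristic 0. *)
Lemma dp_wronskian_neq0 : [pchar C] =i pred0 ->
  \det (\matrix_(i < n, j < n) iter j dp_der (dp_coord i)) != 0.
Proof.
move=> /pcharf0P natr0; pose w : arc := \row_i 'X^i.
have ev_iter k i : dp_eval w (iter k dp_der (dp_coord i)) = 'X^(i - k) *+ i ^_ k.
  rewrite -derivnXn; suff -> f : dp_eval w (iter k dp_der f) = (dp_eval w f)^`(k).
    by congr (_^`(_)); rewrite /dp_eval /= mxE.
  by elim: k => // k IH; rewrite derivnS -IH.
apply/eqP => /(congr1 (dp_eval w)) /eqP; rewrite rmorph0 -det_map_mx det_trig.
  apply/negP/prodf_neq0 => i _; rewrite !mxE [X in X != _]ev_iter subnn ffactnn expr0.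
  by rewrite -polyC1 -polyCMn polyC_eq0 natr0 -lt0n fact_gt0.
by apply/is_trig_mxP => i j ij; rewrite !mxE [LHS]ev_iter ffact_small ?mulr0n.
Qed.
End DiffPoly.

(** * Differential fields with a generic linear action *)

Section GenericSystem.
Variables (C : closedFieldType) (M : diffFieldType) (phi : {rmorphism C -> M}).
Variables (n : nat) (u : 'I_n -> M).

Definition linear_action (s : {rmorphism M -> M}) (c : 'M[C]_n) :=
  (forall k, s (phi k) = phi k) /\
  (forall i, s (u i) = \sum_j phi (c i j) * u j).

(** Invertibility of [c] stands for bijectivity of [s], which [linear_action_bijective] recovers for
    differential [s]. *)
Definition linear_automorphism (s : {rmorphism M -> M}) :=
  exists2 c : 'M[C]_n, c \in unitmx & linear_action s c.

Hypothesis pcharC : [pchar C] =i pred0.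
Hypothesis constM : forall x : M, der x = 0 <-> exists k, x = phi k.
Hypothesis genM : forall P : M -> Prop, diff_subfield P ->
  (forall k, P (phi k)) -> (forall i, P (u i)) -> forall x, P x.
Hypothesis wu : wronskian u != 0.
Hypothesis linM : forall c : 'M[C]_n, c \in unitmx ->
  exists2 s : {rmorphism M -> M}, diff_morphism s & linear_action s c.

Lemma der_phi k : der (phi k) = 0.
Proof. by apply/constM; exists k. Qed.

(** The elements on which [s] and [t] agree form a differential subfield containing the
    generators. *)
Lemma linear_action_eq s t c : diff_morphism s -> diff_morphism t ->
  linear_action s c -> linear_action t c -> s =1 t.
Proof.
move=> ds dt [sC su] [tC tu]; apply: genM => [|k|i]; last by rewrite su tu.
  exact: diff_subfield_eq.
by rewrite sC tC.
Qed.

Lemma linear_action_cancel s t c : diff_morphism s -> diff_morphism t ->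
  c \in unitmx -> linear_action s c -> linear_action t (invmx c) -> cancel s t.
Proof.
move=> ds dt uc [sC su] [tC tu].
have dts : diff_morphism (t \o s : {rmorphism M -> M}).
  by move=> x; rewrite /= ds dt.
(* The composite is compared with the identity on generators, where its matrix is [c *m invmx c]. *)
apply: (genM (diff_subfield_eq dts (t := idfun) (fun=> erefl))) => [k|i] /=.
  by rewrite sC tC.
rewrite su rmorph_sum.
under eq_bigr => j _ do rewrite rmorphM tC tu mulr_sumr.
rewrite exchange_big /=.
transitivity (\sum_j phi ((c *m invmx c) i j) * u j).
  apply: eq_bigr => j _; rewrite mxE rmorph_sum mulr_suml.
  by apply: eq_bigr => k _; rewrite rmorphM mulrA.
rewrite mulmxV // (bigD1 i) //= big1 ?addr0 => [|j /negPf ji].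
  by rewrite mxE eqxx rmorph1 mul1r.
by rewrite mxE eq_sym ji rmorph0 mul0r.
Qed.

Lemma linear_action_bijective s c : diff_morphism s ->
  c \in unitmx -> linear_action s c -> bijective s.
Proof.
move=> ds uc sc; have uc' : invmx c \in unitmx by rewrite unitmx_inv.
have [t dt tc] := linM uc'.
exists t; first exact: linear_action_cancel sc tc.
by apply: linear_action_cancel tc _ => //; rewrite invmxK.
Qed.

Let K := fixed_field linear_automorphism.
Let iota : {rmorphism K -> M} := fixed_incl linear_automorphism.

(** * Constants of the fixed field *)

Lemma fixed_phi k : exists k', phi k = iota k'.
Proof. by apply: fixed_inclP => s [c _ [sC _]] _. Qed.

Lemma const_fixed (x : K) : (x \in @is_const K) = (der (iota x) == 0).
Proof. by rewrite -fixed_incl_diff fmorph_eq0. Qed.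

Lemma constants_phi (k : constants K) : exists k', iota (const_val k) = phi k'.
Proof. by apply/constM/eqP; rewrite -const_fixed const_valP. Qed.

Lemma phi_constants k : exists k' : constants K, phi k = iota (const_val k').
Proof.
have [k' kk'] := fixed_phi k.
have ck : k' \in @is_const K by rewrite const_fixed -kk' der_phi.
by exists (Constant ck).
Qed.

Lemma fixed_same_constants : same_constants iota.
Proof.
move=> x; split=> [/eqP/constM[k ->]|[k ->]]; first exact: phi_constants.
by rewrite -[_ \in _]const_fixed const_valP.
Qed.

(** [constants K] and [C] are distinct types with the same image in [M]; [kval] and [phi] carry
    polynomials and matrices from one to the other. *)
Let kval (k : constants K) : M := iota (const_val k).
Let kvalE k : kval k = iota (val k). Proof. by []. Qed.

Fact kval_is_zmod_morphism : zmod_morphism kval.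
Proof. by move=> x y; rewrite !kvalE !rmorphB. Qed.
Fact kval_is_monoid_morphism : monoid_morphism kval.
Proof. by split=> [|x y]; rewrite !kvalE ?rmorph1 ?rmorphM. Qed.
HB.instance Definition _ :=
  GRing.isZmodMorphism.Build (constants K) M kval kval_is_zmod_morphism.
HB.instance Definition _ :=
  GRing.isMonoidMorphism.Build (constants K) M kval kval_is_monoid_morphism.

(** The coefficients are moved to [C], a root is found there, and the root is moved back. *)
Lemma constants_closed : GRing.closed_field_axiom (constants K).
Proof.
move=> m P m0; have /choice[Q QE] : forall i, exists k, kval (P i) = phi k.
  by move=> i; exact: constants_phi.
have [x xE] := solve_monicpoly Q m0; have [y yE] := phi_constants x.
exists y; apply: (fmorph_inj kval); rewrite rmorphXn rmorph_sum /=.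
rewrite -[kval y]yE -rmorphXn xE rmorph_sum; apply: eq_bigr => i _.
by rewrite !rmorphM !rmorphXn /= QE -[kval y]yE.
Qed.

Lemma fixed_pchar : [pchar K] =i pred0.
Proof. by move=> p; rewrite -(fmorph_pchar iota) (fmorph_pchar phi) pcharC. Qed.

Lemma acts_by_matrixE (s : {rmorphism M -> M}) (c : 'M[constants K]_n) (d : 'M[C]_n) :
  map_mx kval c = map_mx phi d ->
  (forall k, s (iota k) = iota k) ->
  acts_by_matrix iota u s c <-> linear_action s d.
Proof.
move=> /matrixP cd sK.
have e i : \sum_(j < n) iota (const_val (c i j)) * u j = \sum_j phi (d i j) * u j.
  by apply: eq_bigr => j _; have := cd i j; rewrite !mxE => <-.
split=> [su|[_ su] i]; last by rewrite e.
split=> [k|i]; last by rewrite su e.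
by have [k' ->] := fixed_phi k; rewrite sK.
Qed.

Lemma constants_mxP (c : 'M[constants K]_n) :
  exists d : 'M[C]_n, map_mx kval c = map_mx phi d.
Proof.
have /choice[f fE] : forall k, exists k', kval k = phi k' by exact: constants_phi.
by exists (map_mx f c); apply/matrixP => i j; rewrite !mxE fE.
Qed.

(** * The invariant equation and the Galois group *)

Lemma linear_action_wronskian_mx (s : {rmorphism M -> M}) d :
  diff_morphism s -> linear_action s d ->
  map_mx s (wronskian_mx u) = map_mx phi d *m wronskian_mx u.
Proof.
move=> ds [_ su]; apply/matrixP => i j; rewrite !mxE diff_morphism_iter // su.
rewrite iter_der_sum => [|k]; last exact: der_phi.
by apply: eq_bigr => k _; rewrite !mxE.
Qed.

(** Taking determinants, [s] multiplies the wronskian by [phi (\det d)], yet keeps it nonzero. *)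
Lemma linear_action_unitmx s d : diff_morphism s -> linear_action s d ->
  d \in unitmx.
Proof.
move=> ds /(linear_action_wronskian_mx ds) /(congr1 determinant).
rewrite det_mulmx !det_map_mx => e; rewrite unitmxE unitfE -(fmorph_eq0 phi).
apply: contraNneq wu => d0; rewrite -(fmorph_eq0 s).
by rewrite /wronskian -/(wronskian_mx u) e d0 mul0r.
Qed.

Lemma equation_exists : exists a : 'I_n.+1 -> K, fundamental_system iota a u.
Proof.
have uW := wronskian_mx_unit wu.
pose U : 'cV[M]_n := \col_i iter n der (u i).
pose A := invmx (wronskian_mx u) *m U.
have WA : wronskian_mx u *m A = U by rewrite mulKVmx.
have /choice[a aE] : forall j, exists k, A j 0 = iota k.
  move=> j; apply: fixed_inclP => s [c uc sc] ds.
  suff /matrixP/(_ j 0) : map_mx s A = A by rewrite mxE.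
  have uc' : map_mx phi c \in unitmx by rewrite map_unitmx.
  (* [s] multiplies both the wronskian matrix and [U] on the left by [c], so [map_mx s A] solves the
     same invertible system as [A]. *)
  apply: (can_inj (mulKmx uW)); apply: (can_inj (mulKmx uc')).
  rewrite mulmxA -(linear_action_wronskian_mx ds sc) -map_mxM WA.
  apply/colP => i; rewrite !mxE diff_morphism_iter // sc.2.
  rewrite iter_der_sum => [|k]; last exact: der_phi.
  by apply: eq_bigr => k _; rewrite !mxE.
(* Coefficient 1 at order [n] and [- a j] below, since [WA] expresses the [n]-th derivatives through
   the lower ones. *)
exists (fun j => oapp (fun j' => - a j') 1 (unlift ord_max j)); split=> //.
  by rewrite unlift_none /= oner_eq0.
move=> i; rewrite /lin_diff_solution big_ord_recr unlift_none [oapp _ _ _]/= rmorph1 mul1r.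
have e : iter (ord_max : 'I_n.+1) der (u i) = \sum_(j < n) iter j der (u i) * A j 0.
  have /colP/(_ i) := WA; rewrite mxE [RHS]mxE => <-.
  by apply: eq_bigr => j _; rewrite [wronskian_mx u _ _]mxE.
rewrite e -[LHS]/(_ + _) -big_split big1 // => j _.
have -> : widen_ord (leqnSn n) j = lift ord_max j.
  by apply: val_inj; exact: esym (lift_max j).
by rewrite liftK [oapp _ _ _]/= rmorphN -aE lift_max mulNr [A j 0 * _]mulrC; exact: addNr.
Qed.

Theorem generic_system_GL :
  exists (L : diffFieldType) (j : {rmorphism L -> M}) (a : 'I_n.+1 -> L),
    [/\ [pchar L] =i pred0,
        GRing.closed_field_axiom (constants L),
        Picard_Vessiot_by j a u &
        [/\ forall sigma : {rmorphism M -> M}, diff_Galois j sigma ->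
              exists! c : 'M[constants L]_n, acts_by_matrix j u sigma c,
            forall sigma tau : {rmorphism M -> M},
              diff_Galois j sigma -> diff_Galois j tau ->
              forall c : 'M[constants L]_n,
                acts_by_matrix j u sigma c -> acts_by_matrix j u tau c ->
                sigma =1 tau &
            forall c : 'M[constants L]_n,
              (exists2 sigma : {rmorphism M -> M},
                 diff_Galois j sigma & acts_by_matrix j u sigma c)
              <-> c \in unitmx]].
Proof.
have [a fa] := equation_exists; exists K, iota, a; split.
- exact: fixed_pchar.
- exact: constants_closed.
- split=> //; last exact: fixed_same_constants.
  move=> x P dP PK Pu; apply: genM => // k.
  by have [k' ->] := fixed_phi k.
split.
(* [s (u i)] solves the same equation, whose coefficients [s] fixes, so it is a combination of the
   [u j] with constants of [M], all of which come from [K]. Uniqueness is independence of the [u j]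
   over constants. *)
- move=> s [_ ds sK]; have [an au _] := fa.
  pose b j := iota (a j).
  have bn : b ord_max != 0 by rewrite fmorph_eq0.
  have /choice[f fP] i : exists c : 'I_n -> M,
      (forall j, der (c j) = 0) /\ s (u i) = \sum_j c j * u j.
    have [|c dc sc] := wronskian_solution_span wu bn (y := s (u i)) au.
      rewrite -[RHS](rmorph0 s) -[in RHS](au i) rmorph_sum.
      by apply: eq_bigr => k _; rewrite rmorphM sK diff_morphism_iter.
    by exists c.
  have cK i j : exists k : constants K, f i j = kval k.
    by apply/fixed_same_constants/eqP; have [->] := fP i.
  have /choice[g gP] : forall ij, exists k, f ij.1 ij.2 = kval k by move=> ?.
  exists (\matrix_(i, j) g (i, j)); split=> [i|c cs].
    have [_ ->] := fP i; apply: eq_bigr => j _; rewrite mxE; congr (_ * _).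
    exact: (gP (i, j)).
  apply/matrixP => i j; rewrite mxE; apply: (fmorph_inj kval); rewrite -[LHS](gP (i, j)) /=.
  have [df sf] := fP i.
  apply: (wronskian_const_free wu _ _ _ : f i =1 (fun j => kval (c i j))) => // [k|].
    by have [k' e] := constants_phi (c i k); rewrite [kval _]e der_phi.
  by rewrite -sf cs.
- move=> s t [_ ds sK] [_ dt tK] c sc tc; have [d cd] := constants_mxP c.
  apply: (linear_action_eq ds dt (c := d)).
    exact/(acts_by_matrixE cd sK).
  exact/(acts_by_matrixE cd tK).
- move=> c; have [d cd] := constants_mxP c.
  have -> : (c \in unitmx) = (d \in unitmx).
    by rewrite -(map_unitmx kval) cd map_unitmx.
  split=> [[s [_ ds sK] /(acts_by_matrixE cd sK)]|ud].
    exact: linear_action_unitmx.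
  (* The substitution with matrix [d] fixes [K] because [K] was defined as the fixed field of these
     maps. *)
  have [s ds sd] := linM ud.
  have sK k : s (iota k) = iota k by apply: fixed_incl_fix => //; exists d.
  exists s; last exact/(acts_by_matrixE cd sK).
  by split=> //; exact: linear_action_bijective sd.
Qed.

End GenericSystem.

(** * The field of differential rational functions *)

Section DiffPolyField.
Variables (C : closedFieldType) (n : nat).
Local Notation R := (diffpoly_ring C n).

Definition diffpoly_field := {fraction R}.
HB.instance Definition _ := GRing.Field.on diffpoly_field.
HB.instance Definition _ := Field_isDifferential.Build diffpoly_field
  (fraction_derD (@dp_derD C n) (@dp_derM C n)) (fraction_derM (@dp_derM C n)).

Definition dpf_const : {rmorphism C -> diffpoly_field} :=
  @FracField.tofrac R \o @dp_const C n.
Definition dpf_coord i : diffpoly_field := (dp_coord C i)%:F.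

Lemma dpf_der_tofrac (f : R) : der (f%:F : diffpoly_field) = (dp_der f)%:F.
Proof. exact: (fraction_der_tofrac (@dp_derM C n)). Qed.

Lemma dpf_iter_der_tofrac k (f : R) :
  iter k der (f%:F : diffpoly_field) = (iter k (@dp_der C n) f)%:F.
Proof. by elim: k => //= k ->; exact: dpf_der_tofrac. Qed.

(** By the quotient rule [(p / q)' = 0] says that [p] and [q] have vanishing wronskian on every arc,
    so [p] is a constant multiple of [q]. *)
Lemma dpf_constP (x : diffpoly_field) : [pchar C] =i pred0 ->
  der x = 0 <-> exists k, x = dpf_const k.
Proof.
move=> pcharC; split=> [|[k ->]]; last first.
  rewrite [LHS]dpf_der_tofrac (_ : dp_der _ = 0) ?rmorph0 //.
  by apply: dp_evalP => w; exact: derivC.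
have [[p q] /= [q0 ->]] := fraction_div x.
rewrite [LHS]fraction_der_div //; last exact: dp_derM.
move/eqP; rewrite mulf_eq0 invr_eq0 !tofrac_eq0 expf_eq0 (negPf q0) orbF subr_eq0.
move=> /eqP e.
have [w|c cE] := diffpoly_wronskian0 pcharC (diffpoly_ringP p) (diffpoly_ringP q) q0.
  by have := congr1 (dp_eval w) e; rewrite !rmorphM.
exists c; rewrite (_ : p = dp_const n c * q); last exact: dp_evalP.
by rewrite tofracM mulfK ?tofrac_eq0.
Qed.

Lemma dpf_generated (P : diffpoly_field -> Prop) : diff_subfield P ->
  (forall k, P (dpf_const k)) -> (forall i, P (dpf_coord i)) -> forall x, P x.
Proof.
move=> [P1 PB PV PD] Pc Pu x; have [[p q] /= [q0 ->]] := fraction_div x.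
(* Closure under products comes from closure under quotients, as [y * z = y / (1 / z)], valid also
   at [z = 0] since [0^-1 = 0]. *)
have PM y z : P y -> P z -> P (y * z).
  by move=> Py Pz; rewrite -[z]invrK -[z^-1]mul1r; apply: (PV) => //; exact: PV.
suff Pf (f : R) : P f%:F by exact: PV.
elim/dp_generated: f => [//|//|f g Pf Pg|f g Pf Pg|f Pf].
- by rewrite tofracB; exact: PB.
- by rewrite tofracM; exact: PM.
- by rewrite -dpf_der_tofrac; exact: PD.
Qed.

Lemma dpf_wronskian : [pchar C] =i pred0 -> wronskian dpf_coord != 0.
Proof.
move=> pcharC; have := dp_wronskian_neq0 n pcharC.
rewrite -tofrac_eq0 -det_map_mx; congr (\det _ != 0).
apply/matrixP => i j; rewrite !mxE.
exact/esym/dpf_iter_der_tofrac.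
Qed.

(** An invertible substitution is injective on differential polynomials, hence extends to fractions;
    the quotient rule shows that the extension commutes with [der]. *)
Lemma dpf_linear_action (c : 'M[C]_n) : c \in unitmx ->
  exists2 s : {rmorphism diffpoly_field -> diffpoly_field}, diff_morphism s &
    linear_action dpf_const dpf_coord s c.
Proof.
move=> uc; pose f : {rmorphism R -> diffpoly_field} := @FracField.tofrac R \o dp_act c.
have f_inj : injective f.
  by move=> g h /eqP; rewrite /= tofrac_eq => /eqP /dp_act_inj; apply.
pose s : {rmorphism diffpoly_field -> diffpoly_field} := fraction_rmorphism f_inj.
have sF g : s g%:F = (dp_act c g)%:F by exact: fraction_rmorphismE.
exists s; last split=> [k|i].
- move=> x; have [[p q] /= [q0 ->]] := fraction_div x.
  have aq0 : dp_act c q != 0 by rewrite -(rmorph0 (dp_act c)) (inj_eq (dp_act_inj uc)).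
  rewrite [der _]fraction_der_div //; last exact: dp_derM.
  rewrite !fmorph_div !sF [RHS]fraction_der_div //; last exact: dp_derM.
  congr (_ / _); congr (_%:F); last by rewrite rmorphXn.
  by rewrite rmorphB !rmorphM /= !dp_act_der.
- by rewrite [LHS]sF dp_act_const.
- by rewrite [LHS]sF dp_act_coord rmorph_sum; apply: eq_bigr => j _; rewrite rmorphM.
Qed.

End DiffPolyField.

Theorem mainTheorem5 (n : nat) (hn : (1 <= n)%N) :
  exists (K M : diffFieldType) (iota : {rmorphism K -> M})
         (a : 'I_n.+1 -> K) (u : 'I_n -> M),
    [/\ [pchar K] =i pred0,
        GRing.closed_field_axiom (constants K),
        Picard_Vessiot_by iota a u &
        [/\ forall sigma : {rmorphism M -> M}, diff_Galois iota sigma ->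
              exists! c : 'M[constants K]_n, acts_by_matrix iota u sigma c,
            forall sigma tau : {rmorphism M -> M},
              diff_Galois iota sigma -> diff_Galois iota tau ->
              forall c : 'M[constants K]_n,
                acts_by_matrix iota u sigma c -> acts_by_matrix iota u tau c ->
                sigma =1 tau &
            forall c : 'M[constants K]_n,
              (exists2 sigma : {rmorphism M -> M},
                 diff_Galois iota sigma & acts_by_matrix iota u sigma c)
              <-> c \in unitmx]].
Proof.
(* The field of constants is taken to be [algC], algebraically closed of characteristic 0. *)
have [K [iota [a Ka]]] := generic_system_GL Cpchar
  (fun x => dpf_constP x Cpchar) (@dpf_generated algC n)
  (dpf_wronskian n Cpchar) (@dpf_linear_action algC n).
by exists K, (diffpoly_field algC n), iota, a, (@dpf_coord algC n).
Qed.
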